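(* Let $K$ be a field of characteristic zero, let $G=(V,E)$ be a finite undirected graph (multiple edges and loops allowed), and let $\gamma:E\to K\setminus\{0\}$ be a gain function. Suppose that for every cycle $S\subset E$ and any subset $P\subset S$ of its edges, $$\prod_{e\in P}\gamma(e)\neq\prod_{e\in S\setminus P}\gamma(e).$$ Then the Hilbert series of the circulation algebra $\mathcal{C}(G,\sigma,\gamma)$ is independent of the orientation $\sigma$ of $G$. In this case, the dimension $\dim_K\mathcal{C}(G,\sigma,\gamma)$ is equal to the total number of spanning pseudoforests in $G$.
   Context: **Incidence matrix of a gain graph.** Given an orientation $\sigma$ of $G$ and a function $\gamma:E\to K\setminus\{0\}$ (the gain function), the incidence matrix $A_g(G,\sigma,\gamma)=(a_{v,e})_{v\in V,\,e\in E}$ has entries $$a_{v,e}=\begin{cases}0,&\text{if } e \text{ is not incident to } v;\\ -1,&\text{if } e \text{ is not a loop and begins at } v;\\ \gamma(e),&\text{if } e\text{ is not a loop and ends at } v;\\ \gamma(e)-1,&\text{if } e \text{ is a loop at } v.\end{cases}$$ When $\sigma$ changes, the function $\gamma$ on $E$ is kept fixed. **Circulation algebra.** Let $B(E)=K[x_e:e\in E]/(x_e^2:e\in E)$, graded with each $x_e$ in degree $1$, and put $y_v=\sum_{e\in E}a_{v,e}x_e\in B(E)$ for $v\in V$, with $a_{v,e}$ the entries of $A_g(G,\sigma,\gamma)$. The circulation algebra $\mathcal{C}(G,\sigma,\gamma)$ is the (unital) graded $K$-subalgebra of $B(E)$ generated by the $y_v$, $v\in V$. Its Hilbert series is $\sum_{k\ge0}\dim_K\mathcal{C}^k(G,\sigma,\gamma)\,t^k$,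 where $\mathcal{C}^k$ is the degree-$k$ component. **Conventions.** Cycles are identified with their edge sets; a loop is a cycle of length $1$ and a pair of parallel edges is a cycle of length $2$. The empty product equals $1$, and $P=\emptyset$ and $P=S$ are allowed. A spanning pseudoforest is a subset $F\subseteq E$ such that every connected component of the spanning subgraph $(V,F)$ contains at most one cycle, i.e. is a tree or a unicycle (a connected graph with a unique cycle). *)

(* Defs.v *)
From HB Require Import structures.
From mathcomp Require Import all_boot all_algebra all_field.
From mathcomp Require Import mpoly.

Set Implicit Arguments.
Unset Strict Implicit.
Unset Printing Implicit Defensive.

Import GRing.Theory.
Local Open Scope ring_scope.

(* The algebra B(E) = K[x_e : e \in E] / (x_e ^ 2 : e \in E), represented by
   coordinates in its basis of squarefree monomials: f : sqfree K E stands for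
   \sum_(S : {set E}) f S *: \prod_(e in S) x_e. The lemma sqfree_presentation
   below proves that this is the quotient by the ideal generated by the
   squares of the variables. *)
Definition sqfree (K : fieldType) (E : finType) : Type := {ffun {set E} -> K^o}.

Section SquareFree.
Variables (K : fieldType) (E : finType).
Local Notation B := (sqfree K E).

HB.instance Definition _ := Vector.copy B {ffun {set E} -> K^o}.

Definition sqdelta (A : {set E}) : B := [ffun S => (S == A)%:R : K].

Definition sqmul (f g : B) : B :=
  [ffun S : {set E} => \sum_(A : {set E} | A \subset S) (f A : K) * g (S :\: A)].

Fact sqmulC : commutative sqmul.
Proof.
move=> f g; apply/ffunP=> S; rewrite !ffunE.
rewrite (reindex_onto (fun A => S :\: A) (fun A => S :\: A)) /=; last first.
  by move=> A AS; rewrite setDDr setDv set0U; apply/setIidPr.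
apply: eq_big => [A|A /andP[_ /eqP ->]]; last exact: mulrC.
rewrite subsetDl /= setDDr setDv set0U.
by apply/eqP/idP => [<-|/setIidPr //]; rewrite subsetIl.
Qed.

Fact sqmulDl : left_distributive sqmul +%R.
Proof.
move=> f g h; apply/ffunP=> S; rewrite !ffunE -big_split /=.
by apply: eq_bigr => A _; rewrite ffunE mulrDl.
Qed.

Fact sqmul1 : left_id (sqdelta set0) sqmul.
Proof.
move=> f; apply/ffunP=> S; rewrite ffunE (bigD1 set0) ?sub0set //= big1.
  by rewrite ffunE eqxx mul1r setD0 addr0.
by move=> A /andP[_ /negPf A0]; rewrite ffunE A0 mul0r.
Qed.

Fact sqmulA : associative sqmul.
Proof.
move=> f g h; apply/ffunP=> S; rewrite !ffunE.
under eq_bigr => A AS do rewrite ffunE big_distrr /=.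
under [RHS]eq_bigr => A AS do rewrite ffunE big_distrl /=.
rewrite [RHS](exchange_big_dep (fun A : {set E} => A \subset S)) /=; last first.
  by move=> A C AS CA; apply: subset_trans AS.
apply: eq_bigr => A AS.
rewrite [RHS](reindex_onto (fun C => A :|: C) (fun C => C :\: A)) /=; last first.
  move=> C /andP[_ /subsetP AC]; apply/setP=> e; rewrite !inE.
  by case: (boolP (e \in A)) => //= /AC.
apply: eq_big => [C|C].
  rewrite subUset AS subsetUl /= andbT setDUl setDv set0U.
  rewrite subsetD; congr (_ && _); apply/idP/eqP => [/disjoint_setI0|] .
    by move=> CA0; rewrite setDE; apply/setIidPl; rewrite -disjoints_subset -setI_eq0 CA0.
  by move=> <-; rewrite -setI_eq0 setDE -setIA [_ :&: A]setIC setICr setI0.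
rewrite subsetD => /andP[_ dCA].
have -> : (A :|: C) :\: A = C.
  by rewrite setDUl setDv set0U; apply/setDidPl.
by rewrite mulrA setDDl.
Qed.

Fact sqone_neq0 : sqdelta set0 != 0.
Proof.
by apply/eqP=> /ffunP/(_ set0)/eqP; rewrite !ffunE eqxx oner_eq0.
Qed.

HB.instance Definition _ := GRing.Zmodule_isComNzRing.Build B
  sqmulA sqmulC sqmul1 sqmulDl sqone_neq0.

Fact sqscaleAl (a : K) (f g : B) : a *: (f * g) = (a *: f) * g.
Proof.
apply/ffunP=> S; rewrite !ffunE [LHS]mulr_sumr.
by apply: eq_bigr => A _; rewrite ffunE [LHS]mulrA.
Qed.

HB.instance Definition _ := GRing.Lmodule_isLalgebra.Build K B sqscaleAl.
HB.instance Definition _ := GRing.Lalgebra_isComAlgebra.Build K B.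
HB.instance Definition _ := Algebra_isFalgebra.Build K B.

Definition sqvar (e : E) : B := sqdelta [set e].

Lemma sqdeltaM (A C : {set E}) :
  sqdelta A * sqdelta C = if [disjoint A & C] then sqdelta (A :|: C) else 0.
Proof.
apply/ffunP=> S; rewrite ffunE.
under eq_bigr => D _ do rewrite !ffunE.
rewrite (bigID (pred1 A)) /= addrC big1 ?add0r; last first.
  by move=> D /andP[_ /negPf ->]; rewrite mul0r.
have [AS|nAS] := boolP (A \subset S); last first.
  rewrite big1 => [|D /andP[DS /eqP DA]]; last by rewrite DA (negPf nAS) in DS.
  case: ifP => _; rewrite ffunE //; case: eqP => // SAC.
  by rewrite SAC subsetUl in nAS.
rewrite (big_pred1 A) => [|D]; last first.
  by rewrite /= andb_idl // => /eqP ->.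
rewrite eqxx mul1r.
have [dAC|ndAC] := boolP [disjoint A & C]; rewrite ffunE; last first.
  case: eqP => // SAC; case/negP: ndAC.
  by rewrite -SAC -setI_eq0 setDE setICA setICr setI0.
congr (_ %:R); congr (nat_of_bool _); apply/eqP/eqP => [<-|->].
  by apply/setP=> e; rewrite !inE; case: (boolP (e \in A)) => //= /(subsetP AS) ->.
by rewrite setDUl setDv set0U; apply/setDidPl; rewrite disjoint_sym.
Qed.

Lemma sqvar2 (e : E) : sqvar e ^+ 2 = 0.
Proof.
by rewrite expr2 sqdeltaM -setI_eq0 setIid -cards_eq0 cards1.
Qed.

Lemma sqmonE (S : {set E}) : \prod_(e in S) sqvar e = sqdelta S.
Proof.
have prod_seq (s : seq E) :
    uniq s -> \prod_(e <- s) sqvar e = sqdelta [set e in s].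
  elim: s => [_|e s IHs /= /andP[es us]]; first by rewrite big_nil set_nil.
  rewrite big_cons IHs // sqdeltaM disjoints1 inE es set_cons //.
by rewrite -big_enum /= prod_seq ?enum_uniq //; congr sqdelta;
  apply/setP=> e; rewrite inE mem_enum.
Qed.

Let mon (S : {set E}) : 'X_{1..#|E|} :=
  [multinom (enum_val i \in S : nat) | i < #|E|].

Let mon_inj : injective mon.
Proof.
move=> S T /mnmP eqST; apply/setP=> e; move: (eqST (enum_rank e)).
by rewrite !mnmE enum_rankK; do 2!case: (e \in _).
Qed.

Let val_var (i : 'I_#|E|) : B := sqvar (enum_val i).

Let mmap1_mon S : mmap1 val_var (mon S) = sqdelta S.
Proof.
rewrite -sqmonE /mmap1.
transitivity (\prod_(e in E) if e \in S then sqvar e else 1);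
  last by rewrite [RHS]big_mkcond; apply: eq_bigl.
rewrite [RHS]big_enum_val. apply: eq_bigr => i _.
by rewrite mnmE; case: (_ \in S).
Qed.

Let mmap1E m S : mmap1 val_var m S = (m == mon S)%:R.
Proof.
have [/existsP[i mi]|] := boolP [exists i, 1 < m i]%N.
  rewrite /mmap1 (bigD1 i) //= -(subnK mi) exprD sqvar2 mulr0 mul0r ffunE.
  case: eqP => // eq_m; move: mi.
  by rewrite eq_m mnmE; case: (_ \in _).
rewrite negb_exists => /forallP m_le1.
have -> : m = mon [set e | m (enum_rank e) == 1%N].
  apply/mnmP=> i; rewrite mnmE inE enum_valK.
  by case: (m i) (m_le1 i) => [|[|]].
by rewrite mmap1_mon (inj_eq mon_inj) ffunE eq_sym.
Qed.

Let eval := mmap (in_alg B) val_var.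

Let evalE p S : eval p S = p@_(mon S).
Proof.
rewrite /eval /mmap sum_ffunE.
under eq_bigr => m _ do rewrite mulr_algl ffunE mmap1E.
have [Sp|Sp] := boolP (mon S \in msupp p).
  rewrite (bigD1_seq (mon S)) ?msupp_uniq //= eqxx big1 ?addr0 => [|m /negPf ->].
    exact: mulr1.
  exact: mulr0.
rewrite (memN_msupp_eq0 Sp) big_seq big1 // => m mp.
by case: eqP => [mS|_]; [rewrite -mS mp in Sp | exact: mulr0].
Qed.

Let eval_scalable : scalable eval.
Proof. by move=> c p; rewrite /eval mmapZ mulr_algl. Qed.

Lemma sqfree_presentation :
  exists phi : {lrmorphism {mpoly K[#|E|]} -> B},
  [/\ forall i, phi 'X_i = sqvar (enum_val i),
      forall b, exists p, phi p = b &
      forall p, phi p = 0 <->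
        exists c : 'I_#|E| -> {mpoly K[#|E|]}, p = \sum_i c i * 'X_i ^+ 2].
Proof.
pose evalS := GRing.isScalable.Build K {mpoly K[#|E|]} B *:%R eval eval_scalable.
pose phi : {lrmorphism {mpoly K[#|E|]} -> B} := HB.pack (mmap (in_alg B) val_var) evalS.
exists phi; split=> [i|b|p].
- by rewrite /= /eval mmapX mmap1U.
- exists (\sum_S (b S : K) *: 'X_[mon S]); apply/ffunP=> S.
  rewrite evalE raddf_sum (bigD1 S) //= big1 => [|T TS].
    by rewrite mcoeffZ mcoeffX eqxx mulr1 addr0.
  by rewrite mcoeffZ mcoeffX (inj_eq mon_inj) (negPf TS) mulr0.
split=> [/ffunP p0|[c ->]]; last first.
  rewrite (rmorph_sum phi) big1 // => i _.
  by rewrite (rmorphM phi) (rmorphXn phi) /= /eval mmapX mmap1U sqvar2 mulr0.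
rewrite (mpolyE p) big_seq.
elim/big_ind: _ => [|q r [c ->] [d ->]|m mp].
- by exists (fun=> 0); rewrite big1 // => i _; rewrite mul0r.
- exists (fun i => c i + d i); rewrite -big_split /=.
  by apply: eq_bigr => i _; rewrite mulrDl.
have [/existsP[i mi]|] := boolP [exists i, 1 < m i]%N.
  exists (fun j => if j == i then p@_m *: 'X_[m - U_(i) *+ 2] else 0).
  rewrite (bigD1 i) //= eqxx big1 ?addr0 => [|j /negPf ->]; last exact: mul0r.
  rewrite -scalerAl mpolyXn -mpolyXD submK //.
  apply/mnm_lepP=> j; rewrite mulmnE mnm1E.
  by case: eqP => [<-|_]; rewrite ?mul1n.
rewrite negb_exists => /forallP m_le1.
move: mp; rewrite mcoeff_msupp.
have -> : m = mon [set e | m (enum_rank e) == 1%N].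
  apply/mnmP=> i; rewrite mnmE inE enum_valK.
  by case: (m i) (m_le1 i) => [|[|]].
by rewrite -evalE p0 ffunE eqxx.
Qed.
End SquareFree.

Definition sqhom (K : fieldType) (E : finType) (k : nat) : {vspace sqfree K E} :=
  <<[seq \prod_(e in A) sqvar K e | A : {set E} in [set A : {set E} | #|A| == k]]>>%VS.

(* Finite undirected multigraphs: ends e is the set of the endpoints of e, a
   singleton when e is a loop; the bounds on its cardinal say that e has one or
   two endpoints. *)
Record mgraph := MGraph {
  vertex : finType;
  edge : finType;
  ends : edge -> {set vertex};
  _ : forall e, (0 < #|ends e| <= 2)%N
}.

Section Graph.
Variable G : mgraph.
Local Notation V := (vertex G).
Local Notation E := (edge G).

Definition is_loop (e : E) : bool := #|ends e| == 1%N.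

Record orientation := Orientation {
  src : E -> V;
  tgt : E -> V;
  _ : forall e, ends e = [set src e; tgt e]
}.

(* S is the edge set of a closed walk v_0 e_0 v_1 e_1 ... v_(k-1) e_(k-1) v_0
   of length k = #|S| > 0 with distinct vertices and distinct edges; ordS is
   the cyclic successor on 'I_k. *)
Definition is_cycle (S : {set E}) : bool :=
  (0 < #|S|)%N &&
  [exists v : {ffun 'I_#|S| -> V}, [exists e : {ffun 'I_#|S| -> E},
    [&& injectiveb v, injectiveb e, [set e i | i : 'I_#|S|] == S &
        [forall i, ends (e i) == [set v i; v (ordS i)]]]]].

Definition adjacent (F : {set E}) : rel V :=
  [rel u v | [exists e in F, ends e == [set u; v]]].

Definition component_edges (F : {set E}) (v : V) : {set E} :=
  [set e in F | [exists u in ends e, connect (adjacent F) v u]].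

Definition is_pseudoforest (F : {set E}) : bool :=
  [forall v : V,
    #|[set S : {set E} | is_cycle S & S \subset component_edges F v]| <= 1]%N.

Section Circulation.
Variables (K : fieldType) (sigma : orientation) (gamma : E -> K).

Definition incidence (v : V) (e : E) : K :=
  if v \notin ends e then 0
  else if is_loop e then gamma e - 1
  else if v == src sigma e then -1
  else gamma e.

Definition circ_gen (v : V) : sqfree K E :=
  \sum_(e : E) incidence v e *: sqvar K e.

Definition circulation : {aspace sqfree K E} :=
  <<1 & [seq circ_gen v | v : V]>>%AS.

(* The degree k coefficient of the Hilbert series. *)
Definition circ_hilbert (k : nat) : nat :=
  \dim (circulation :&: sqhom K E k)%VS.
End Circulation.
End Graph.

(* Main.v *)
From HB Require Import structures.
Require Import Defs.
From mathcomp Require Import all_boot all_algebra all_field.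

(** The coordinates of the generators y_v form the rows of the incidence
    matrix A, and the whole argument concerns an arbitrary space W of linear
    forms in B(E), here the span of the y_v, together with the matroid on E
    formed by the columns of A: a set F is independent when every assignment
    of values to F is taken by the coordinates of some form of W. Two facts are
    combined: the Hilbert series of the algebra generated by W is determined by
    this matroid and its dimension is the number of independent sets
    (dim_agenv, dim_agenv_hom), and for an unbalanced gain function its
    independent sets are the spanning pseudoforests, whatever the orientation
    (independentE).

    Lower bound. The operator d/dx_e maps the algebra of W onto the algebra of
    the deletion of e, because it sends l ^ (j + 1) * g to a nonzero multiple of
    l ^ j * g when l involves x_e and g does not; this is where characteristic
    zero enters. It kills the algebra of the contraction {l in W | l_e = 0}.
    Independent sets avoiding e are independent in the deletion and those
    containing e come from independent sets of the contraction, so by induction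
    the dimension is at least the number of independent sets
    (card_independent_le_dim).

    Upper bound. A linear relation sum_e lam_e * a_e = 0 between columns forces
    sum_e lam_e * f_(R + e) = 0 for each f of the algebra and each R disjoint
    from the support of lam (relation_agenv). Fix a total order on E and call T
    saturated if it contains each c that depends on the smaller elements of T.
    If c, outside T, depends on smaller elements of T, the relation
    expresses the coordinate of f at the complement of T through coordinates at
    complements of the sets T + c - t with t < c, so by descent f is determined
    by its coordinates at complements of saturated sets
    (saturated_separating). A saturated set T can be recovered from its greedy
    basis, so there are at most as many saturated as independent sets
    (card_saturated_le). Hence the bounds agree, restriction to these
    coordinates is bijective, and, as the algebra is graded, the degree k part
    has one dimension per saturated set with k elements in its complement.

    Pseudoforests. A form sum_v psi_v y_v has coordinate
    gamma(e) psi(tgt e) - psi(src e) at e, so it vanishes at e when psi is a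
    potential for the gain of e. Multiplying these equations around a cycle
    gives an equality of two products excluded by the hypothesis unless psi
    vanishes somewhere on the cycle (cycle_potential_eq0), while on a connected
    acyclic set there is a nowhere zero potential (acyclic_potential). If a
    component has two cycles and e is an edge of one of them outside the other,
    a potential for all the edges but e has a zero on the other cycle, which
    spreads over the component, so e depends on the other edges. Conversely, an
    edge added to a pseudoforest while keeping it one either joins an acyclic
    component to another component or closes the first cycle of an acyclic
    component; the potential of this acyclic component, extended by zero, shows
    that the new edge is independent of the old ones. *)

Set Implicit Arguments.
Unset Strict Implicit.
Unset Printing Implicit Defensive.

Import GRing.Theory.
Local Open Scope ring_scope.

(** * The square-free algebra: coordinates, derivations, projections *)

(** Induction on products of generators. The predicate is not required to be
    the membership in a subspace given in advance, and the lower bound needs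
    that: its predicate quantifies over all powers of a form. *)
Lemma agenv_ind (K : fieldType) (aT : falgType K) (U : {vspace aT})
    (P : aT -> Prop) :
  P 1 -> (forall a f g, P f -> P g -> P (a *: f + g)) ->
  (forall u f, u \in U -> P f -> P (u * f)) ->
  forall f, f \in agenv U -> P f.
Proof.
move=> P1 PD PM.
have P0 : P 0 by have := PD (-1) _ _ P1 P1; rewrite scaleN1r addNr.
have Psum (I : Type) (r : seq I) (F : I -> aT) (c : I -> K) :
    (forall i, P (F i)) -> P (\sum_(i <- r) c i *: F i).
  move=> PF; elim: r => [|i r IHr]; first by rewrite big_nil.
  by rewrite big_cons; apply: PD.
have PU n f : f \in (U ^+ n)%VS -> P f.
  elim: n f => [|n IHn] f.
    by rewrite expv0 => /vlineP[a ->]; rewrite -[_ *: _]addr0; apply: PD.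
  rewrite expvSl /prodv unlock => /(coord_span (X := in_tuple _)) ->.
  apply: Psum => i.
  have /allpairsP[[u v] /= [uU vU ->]] := mem_nth 0 (ltn_ord i).
  by apply: PM; [exact: vbasis_mem uU | exact/IHn/vbasis_mem].
move=> f /memv_sumP[g gU ->].
rewrite (eq_bigr (fun i => 1 *: g i)) => [|i _]; last by rewrite scale1r.
elim/big_rec: _ => // i h _ Ph; apply: PD => //.
exact: PU (gU i isT).
Qed.

Section SquareFreeAlgebra.
Variables (K : fieldType) (E : finType).
Local Notation B := (sqfree K E).
Implicit Types (f g : B) (S T A : {set E}) (e : E).

Lemma sqcoefD f g S : (f + g) S = (f S : K) + g S.
Proof. by rewrite ffunE. Qed.

Lemma sqcoefZ a f S : (a *: f) S = a * (f S : K).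
Proof. by rewrite ffunE. Qed.

Lemma sqcoef0 S : (0 : B) S = 0.
Proof. by rewrite ffunE. Qed.

Lemma sqcoef1 S : (1 : B) S = (S == set0)%:R.
Proof. by rewrite ffunE. Qed.

Lemma sqcoef_sum (I : Type) (r : seq I) (P : pred I) (F : I -> B) S :
  (\sum_(i <- r | P i) F i) S = \sum_(i <- r | P i) (F i S : K).
Proof. exact: (sum_ffunE r P F S). Qed.

Lemma sqcoefM f g S :
  (f * g) S = \sum_(A : {set E} | A \subset S) (f A : K) * g (S :\: A).
Proof. by rewrite ffunE. Qed.

Definition sqspan (X : {set {set E}}) : {vspace B} :=
  <<[seq sqdelta K A | A in X]>>%VS.

Lemma sqcoef_delta A S : (sqdelta K A : B) S = (S == A)%:R.
Proof. by rewrite ffunE. Qed.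

Lemma sum_delta f : f = \sum_A (f A : K) *: sqdelta K A.
Proof.
apply/ffunP => S; rewrite sqcoef_sum (bigD1 S) //= big1 ?addr0.
  by rewrite sqcoefZ sqcoef_delta eqxx mulr1.
by move=> A AS; rewrite sqcoefZ sqcoef_delta eq_sym (negPf AS) mulr0.
Qed.

Lemma sqspanP (X : {set {set E}}) f :
  reflect (forall S, S \notin X -> (f S : K) = 0) (f \in sqspan X).
Proof.
apply: (iffP idP) => [/(coord_span (X := in_tuple _)) -> S SX|fX].
  rewrite sqcoef_sum big1 // => i _; rewrite sqcoefZ.
  have /imageP[A AX ->] := mem_nth 0 (ltn_ord i).
  by rewrite sqcoef_delta; case: eqP => [SA|]; [rewrite SA AX in SX | rewrite mulr0].
rewrite (sum_delta f); apply: rpred_sum => A _.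
have [AX|/fX ->] := boolP (A \in X); last by rewrite scale0r mem0v.
by apply/memvZ/memv_span/image_f.
Qed.

Lemma dim_sqspan (X : {set {set E}}) : \dim (sqspan X) = #|X|.
Proof.
rewrite /sqspan -(size_image (@sqdelta K E) X); apply/eqP.
set s := image _ _; rewrite -/(free s).
apply/(@freeP _ _ _ (in_tuple s)) => k k0 i.
have nthE (j : 'I_(size s)) : s`_j = sqdelta K (nth set0 (enum X) j).
  by rewrite (nth_map set0) // -(size_map (@sqdelta K E)) -/s ltn_ord.
have /ffunP/(_ (nth set0 (enum X) i)) := k0.
rewrite sqcoef_sum (bigD1 i) //= big1 => [|j ji]; last first.
  rewrite sqcoefZ nthE sqcoef_delta nth_uniq ?enum_uniq //.
  - by rewrite eq_sym val_eqE (negPf ji) mulr0.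
  - by rewrite -(size_map (@sqdelta K E)) -/s ltn_ord.
  - by rewrite -(size_map (@sqdelta K E)) -/s ltn_ord.
by rewrite sqcoefZ nthE sqcoef_delta eqxx mulr1 addr0 sqcoef0.
Qed.

Lemma sqhomE k : sqhom K E k = sqspan [set A : {set E} | #|A| == k].
Proof.
by rewrite /sqhom /sqspan; congr <<_>>%VS; apply: eq_map => A; rewrite sqmonE.
Qed.

Lemma sqhomP k f :
  reflect (forall S, #|S| != k -> (f S : K) = 0) (f \in sqhom K E k).
Proof.
rewrite sqhomE; apply: (iffP (sqspanP _ _)) => fk S.
  by move=> Sk; apply: fk; rewrite inE.
by rewrite inE; apply: fk.
Qed.

(** The derivative d/dx_e; since x_e squares to zero, f is the sum of
    sqdrop e f and of x_e times sqdiff e f. *)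
Definition sqdiff e f : B :=
  [ffun S : {set E} => if e \in S then 0 else f (e |: S) : K].

(** The substitution x_e = 0, kept inside the same algebra. *)
Definition sqdrop e f : B := [ffun S : {set E} => if e \in S then 0 else f S : K].

Fact sqdiff_linear e : linear (sqdiff e).
Proof.
move=> a f g; apply/ffunP => S; rewrite sqcoefD sqcoefZ !ffunE.
by case: ifP; rewrite ?mulr0 ?addr0.
Qed.
HB.instance Definition _ e :=
  GRing.isLinear.Build K B B *:%R (sqdiff e) (sqdiff_linear e).

Fact sqdrop_linear e : linear (sqdrop e).
Proof.
move=> a f g; apply/ffunP => S; rewrite sqcoefD sqcoefZ !ffunE.
by case: ifP; rewrite ?mulr0 ?addr0.
Qed.
HB.instance Definition _ e :=
  GRing.isLinear.Build K B B *:%R (sqdrop e) (sqdrop_linear e).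

Lemma sqcoef_diff e f S : sqdiff e f S = if e \in S then 0 else f (e |: S) : K.
Proof. by rewrite ffunE. Qed.

Lemma sqcoef_drop e f S : sqdrop e f S = if e \in S then 0 else f S : K.
Proof. by rewrite ffunE. Qed.

Lemma sqdropM e f g : sqdrop e (f * g) = sqdrop e f * sqdrop e g.
Proof.
apply/ffunP => S; rewrite sqcoef_drop !sqcoefM; case: ifPn => eS.
  rewrite big1 // => A AS; rewrite !sqcoef_drop !inE eS andbT.
  by case: ifP => _ /=; rewrite ?mul0r ?mulr0.
apply: eq_bigr => A AS; rewrite !sqcoef_drop !inE (negPf eS) andbF.
by rewrite (contraNF ((subsetP AS) e) eS).
Qed.

Lemma sqdrop1 e : sqdrop e 1 = 1.
Proof.
apply/ffunP => S; rewrite sqcoef_drop sqcoef1; case: ifP => // eS.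
by case: eqP => // S0; rewrite S0 inE in eS.
Qed.

Lemma sqdiff1 e : sqdiff e 1 = 0.
Proof.
apply/ffunP => S; rewrite sqcoef_diff sqcoef1 sqcoef0; case: ifP => // _.
by rewrite -subset0 subUset sub1set inE.
Qed.

(** The Leibniz rule needs the substitution x_e = 0 in the other factor, as
    d/dx_e does not preserve the relation x_e ^ 2 = 0. *)
Lemma sqdiffM e f g :
  sqdiff e (f * g) = sqdiff e f * sqdrop e g + sqdrop e f * sqdiff e g.
Proof.
apply/ffunP => S; rewrite sqcoefD sqcoef_diff !sqcoefM; case: ifPn => eS.
  rewrite !big1 ?addr0 // => A AS; rewrite !(sqcoef_drop, sqcoef_diff) !inE eS andbT.
    by case: ifP => _ /=; rewrite ?mul0r ?mulr0.
  by case: ifP => _ /=; rewrite ?mul0r ?mulr0.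
rewrite (bigID (fun A : {set E} => e \in A)) /=; congr (_ + _).
  rewrite (reindex_onto (fun A => e |: A) (fun A => A :\ e)) /=; last first.
    by move=> A /andP[_ eA]; rewrite setD1K.
  apply: eq_big => [A|A /andP[/andP[AS _] /eqP eA]].
    rewrite subUset sub1set !setU11 /=.
    have [eA|eA] := boolP (e \in A).
      have /negPf -> : ~~ (A \subset S) by apply: contra eS => /subsetP/(_ e eA).
      by apply/negP=> /andP[_ /eqP/setP/(_ e)]; rewrite !inE eqxx eA.
    rewrite setU1K // eqxx !andbT /=.
    by rewrite -{2}(setU1K eS) subsetD1 eA andbT.
  have eA' : e \notin A by rewrite -eA !inE eqxx.
  rewrite sqcoef_drop sqcoef_diff (negPf eA') !inE (negPf eS) andbF.
  congr (_ * g _); apply/setP=> x; rewrite !inE.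
  by case: eqP => //= ->; rewrite (negPf eS) andbF.
apply: eq_big => [A|A /andP[AS eA]].
  rewrite -{2}(setU1K eS) subsetD1; case: (e \in A) => //=.
rewrite sqcoef_drop sqcoef_diff (negPf eA) !inE (negPf eS) andbF.
congr (_ * g _); apply/setP=> x; rewrite !inE.
by case: eqP => //= ->; rewrite eA.
Qed.
End SquareFreeAlgebra.

Section Projection.
Variables (K : fieldType) (E : finType).
Local Notation B := (sqfree K E).
Implicit Types (f g : B) (X : {set {set E}}) (S T A : {set E}) (e : E).

Definition sqproj X f : B :=
  [ffun S : {set E} => if S \in X then f S else 0 : K].

Fact sqproj_linear X : linear (sqproj X).
Proof.
move=> a f g; apply/ffunP => S; rewrite sqcoefD sqcoefZ !ffunE.
by case: ifP; rewrite ?mulr0 ?addr0.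
Qed.
HB.instance Definition _ X :=
  GRing.isLinear.Build K B B *:%R (sqproj X) (sqproj_linear X).

Lemma sqcoef_proj X f S : sqproj X f S = if S \in X then f S else 0 : K.
Proof. by rewrite ffunE. Qed.

Lemma limg_proj_sub X (U : {vspace B}) :
  (linfun (sqproj X) @: U <= sqspan K X)%VS.
Proof.
apply/subvP=> _ /memv_imgP[f _ ->]; apply/sqspanP => S SX.
by rewrite lfunE sqcoef_proj (negPf SX).
Qed.

(** The coordinates indexed by X are linearly independent on U exactly when U
    contains a family dual to them. *)
Lemma interpolationP X (U : {vspace B}) :
  reflect (forall S, S \in X ->
             exists2 f, f \in U & forall T, T \in X -> (f T : K) = (T == S)%:R)
          (\dim (linfun (sqproj X) @: U) == #|X|).
Proof.
rewrite -(dim_sqspan K X) (dimv_leqif_sup (limg_proj_sub X U)).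
apply: (iffP idP) => [sXU S SX | interp].
  have : sqdelta K S \in sqspan K X.
    by apply/sqspanP => T TX; rewrite sqcoef_delta; case: eqP => // TS; rewrite TS SX in TX.
  move=> /(subvP sXU) /memv_imgP[f fU deltaE]; exists f => // T TX.
  by rewrite -sqcoef_delta deltaE lfunE sqcoef_proj TX.
apply/span_subvP => _ /imageP[S SX ->].
have [f fU fE] := interp S SX; apply/memv_imgP; exists f => //.
apply/ffunP => T; rewrite lfunE sqcoef_proj sqcoef_delta; case: ifPn => [/fE //|].
by case: eqP => // ->; rewrite SX.
Qed.

(** Elements determined by their coordinates in X: no dimension is lost by
    keeping these coordinates only. *)
Lemma dim_le_separating X (U : {vspace B}) :
  (forall f, f \in U -> (forall S, S \in X -> (f S : K) = 0) -> f = 0) ->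
  \dim (linfun (sqproj X) @: U) = \dim U.
Proof.
move=> sepU; apply: limg_dim_eq; apply/eqP; rewrite -subv0; apply/subvP => f.
rewrite memv_cap memv_ker => /andP[fU /eqP f0]; rewrite memv0; apply/eqP.
apply: sepU => // S SX; have := f0; rewrite lfunE => /ffunP/(_ S).
by rewrite sqcoef_proj SX sqcoef0.
Qed.
End Projection.

(** * Independent sets, deletion and contraction *)

Section Independence.
Variables (K : fieldType) (E : finType).
Local Notation B := (sqfree K E).
Implicit Types (W : {vspace B}) (l : B) (F : {set E}) (e : E).

Definition singletons F : {set {set E}} := [set [set e] | e in F].

Lemma card_singletons F : #|singletons F| = #|F|.
Proof. by rewrite card_imset //; apply: set1_inj. Qed.

(** When W is the row space of a matrix with columns indexed by E, the rank of
    the projection on the coordinates in F is the rank of the columns in F. *)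
Definition independent W F := \dim (linfun (sqproj (singletons F)) @: W) == #|F|.

Lemma independentP W F :
  reflect (forall e, e \in F ->
             exists2 l, l \in W & forall x, x \in F -> (l [set x] : K) = (x == e)%:R)
          (independent W F).
Proof.
rewrite /independent -card_singletons.
apply: (iffP (interpolationP _ _)) => dualF.
  move=> e eF; have [l lW lE] := dualF [set e] (imset_f _ eF).
  by exists l => // x xF; rewrite lE ?imset_f // (inj_eq set1_inj).
move=> _ /imsetP[e eF ->]; have [l lW lE] := dualF e eF.
by exists l => // _ /imsetP[x xF ->]; rewrite lE // (inj_eq set1_inj).
Qed.

Lemma dual_family W F : independent W F ->
  exists d : E -> B, forall e, e \in F ->
    d e \in W /\ forall x, x \in F -> (d e [set x] : K) = (x == e)%:R.
Proof.
move/independentP => dualF.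
apply: (fin_all_exists (P := fun e l => e \in F -> l \in W /\
  forall x, x \in F -> (l [set x] : K) = (x == e)%:R)) => e.
by case: (boolP (e \in F)) => [/dualF[l] | _]; [exists l | exists 0].
Qed.

Lemma independent_interp W F (c : E -> K) : independent W F ->
  exists2 l, l \in W & forall x, x \in F -> (l [set x] : K) = c x.
Proof.
move=> /dual_family[d dP].
exists (\sum_(e in F) c e *: d e) => [|x xF].
  by apply: rpred_sum => e eF; apply: memvZ; case: (dP e eF).
rewrite sqcoef_sum (bigD1 x) //= big1 => [|e /andP[eF ex]].
  by rewrite sqcoefZ (dP x xF).2 // eqxx mulr1 addr0.
by rewrite sqcoefZ (dP e eF).2 // eq_sym (negPf ex) mulr0.
Qed.

Lemma independentS W F1 F2 : F1 \subset F2 -> independent W F2 -> independent W F1.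
Proof.
move=> /subsetP sF /independentP dualF; apply/independentP => e /sF/dualF[l lW lE].
by exists l => // x /sF/lE.
Qed.

(** A correction by a multiple of l adjusts the value at e of an interpolating
    form without changing its values on F. *)
Lemma independentU1 W F e l :
  independent W F -> l \in W -> (forall x, x \in F -> (l [set x] : K) = 0) ->
  (l [set e] : K) != 0 -> independent W (e |: F).
Proof.
move=> indF lW lF le; apply/independentP => y yF.
have [d dW dE] := independent_interp (fun x => (x == y)%:R) indF.
exists (d + (((e == y)%:R - (d [set e] : K)) / l [set e]) *: l) => [|x].
  by rewrite memvD ?memvZ.
rewrite !inE sqcoefD sqcoefZ => /predU1P[->|xF]; last by rewrite (lF x) // mulr0 addr0 dE.
by rewrite mulfVK // addrC subrK.
Qed.

(** In terms of row spaces, deleting a column forgets a coordinate, and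
    contracting it keeps the vectors where this coordinate vanishes. *)
Definition delete W e := (linfun (@sqdrop K E e) @: W)%VS.
Definition contract W e := (W :&: lker (linfun (@sqdiff K E e)))%VS.

Lemma independent_delete W F e :
  e \notin F -> independent W F -> independent (delete W e) F.
Proof.
move=> eF /independentP dualF; apply/independentP => y /dualF[l lW lE].
exists (sqdrop e l); first by apply/memv_imgP; exists l; rewrite ?lfunE.
move=> x xF; rewrite sqcoef_drop inE; case: eqP => [ex|_]; last exact: lE.
by rewrite ex xF in eF.
Qed.

Lemma mem_contract W l e : (W <= sqhom K E 1)%VS ->
  (l \in contract W e) = (l \in W) && ((l [set e] : K) == 0).
Proof.
move=> /subvP W1; rewrite memv_cap memv_ker lfunE.
case: (boolP (l \in W)) => //= /W1/sqhomP l1.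
apply/eqP/eqP => [/ffunP/(_ set0)|le]; first by rewrite sqcoef_diff inE setU0 sqcoef0.
apply/ffunP => S; rewrite sqcoef_diff sqcoef0; case: ifPn => // eS.
have [->|S0] := eqVneq S set0; first by rewrite setU0.
by apply: l1; rewrite cardsU1 eS eqSS cards_eq0.
Qed.

Lemma independent_contract W F e : (W <= sqhom K E 1)%VS ->
  e \in F -> independent W F -> independent (contract W e) (F :\ e).
Proof.
move=> W1 eF /independentP dualF; apply/independentP => y.
rewrite !inE => /andP[ye /dualF[l lW lE]].
exists l; first by rewrite mem_contract // lW lE // [e == y]eq_sym (negPf ye) eqxx.
by move=> x; rewrite !inE => /andP[_ /lE].
Qed.

(** Independent sets that avoid e survive the deletion of e, and removing e
    from the others gives independent sets of the contraction. *)
Lemma card_independent_le W e : (W <= sqhom K E 1)%VS ->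
  (#|[set F | independent W F]| <=
   #|[set F | independent (delete W e) F]|
   + #|[set F | independent (contract W e) F]|)%N.
Proof.
move=> W1; rewrite -(cardsID [set F : {set E} | e \in F]) addnC leq_add //.
  apply/subset_leq_card/subsetP => F; rewrite !inE => /andP[eF].
  exact: independent_delete.
rewrite -(card_in_imset (f := fun F : {set E} => F :\ e)); last first.
  move=> F1 F2; rewrite !inE => /andP[_ eF1] /andP[_ eF2] F12.
  by rewrite -(setD1K eF1) F12 setD1K.
apply/subset_leq_card/subsetP => _ /imsetP[F + ->]; rewrite !inE => /andP[indF eF].
exact: independent_contract.
Qed.
End Independence.

(** * Lower bound: deletion and contraction *)

Section Dimension.
Variables (K : fieldType) (E : finType).
Local Notation B := (sqfree K E).
Implicit Types (W : {vspace B}) (f g l : B) (F R S T : {set E}) (e c : E).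

Lemma diff_lin l e : l \in sqhom K E 1 -> sqdiff e l = (l [set e] : K) *: 1.
Proof.
move=> /sqhomP l1; apply/ffunP => S; rewrite sqcoefZ sqcoef1 sqcoef_diff.
have [->|S0] := eqVneq S set0; first by rewrite inE setU0 mulr1.
rewrite mulr0; case: ifPn => // eS.
by apply: l1; rewrite cardsU1 eS eqSS cards_eq0.
Qed.

Lemma drop_contract W u e : u \in contract W e -> sqdrop e u = u.
Proof.
rewrite memv_cap memv_ker => /andP[_ /eqP u0]; apply/ffunP => S.
rewrite sqcoef_drop; case: ifP => // eS.
have := u0; rewrite lfunE => /ffunP/(_ (S :\ e)).
by rewrite sqcoef_diff sqcoef0 !inE eqxx setD1K //=.
Qed.

Lemma diff_contract W u e : u \in contract W e -> sqdiff e u = 0.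
Proof. by rewrite memv_cap memv_ker lfunE => /andP[_ /eqP]. Qed.

Lemma agenv_contract_sub W e :
  (agenv (contract W e) <= agenv W :&: lker (linfun (@sqdiff K E e)))%VS.
Proof.
rewrite subv_cap agenvS ?capvSl //=; apply: agenv_sub_modl.
  by rewrite -memvE memv_ker lfunE /= sqdiff1.
apply/prodvP => u f uW; rewrite !memv_ker !lfunE /= => /eqP f0.
by rewrite sqdiffM (diff_contract uW) f0 mul0r mulr0 addr0.
Qed.

Hypothesis K0 : [pchar K] =i pred0.

(** With d for l at x_e = 0, the elements d ^ j * g, where g is in the algebra
    of the contraction, span the algebra of the deletion, and each is a multiple of
    the derivative of l ^ (j + 1) * g because g does not involve x_e. The
    induction carries all the powers of d along, since the product of d and a
    derivative is not visibly a derivative. *)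
Lemma agenv_delete_sub W e l : (W <= sqhom K E 1)%VS -> l \in W ->
  (l [set e] : K) != 0 ->
  (agenv (delete W e) <= linfun (@sqdiff K E e) @: agenv W)%VS.
Proof.
move=> W1 lW le; pose d : B := sqdrop e l.
have XP f : f \in agenv W -> sqdiff e f \in (linfun (@sqdiff K E e) @: agenv W)%VS.
  by move=> fA; apply/memv_imgP; exists f; rewrite ?lfunE.
have memA u f : u \in W -> f \in agenv W -> u * f \in agenv W.
  move=> uW fA; rewrite -(agenvM W) memv_mul //.
  exact: subvP (sub_agenv W) _ uW.
have powA j : l ^+ j \in agenv W.
  elim: j => [|j IHj]; last by rewrite exprS memA.
  by rewrite expr0 memvE sub1_agenv.
have diffX j : sqdiff e (l ^+ j.+1) = (j.+1%:R * (l [set e] : K)) *: d ^+ j.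
  elim: j => [|j IHj].
    by rewrite expr1 expr0 mul1r diff_lin // (subvP W1).
  rewrite exprS sqdiffM IHj diff_lin ?(subvP W1) // -scalerAl mul1r.
  have -> n : sqdrop e (l ^+ n) = d ^+ n.
    elim: n => [|n IHn]; first by rewrite !expr0 sqdrop1.
    by rewrite !exprS sqdropM IHn.
  by rewrite -scalerAr -exprS -scalerDl -[j.+2%:R]natr1 mulrDl mul1r addrC.
have powX j : d ^+ j \in (linfun (@sqdiff K E e) @: agenv W)%VS.
  have c0 : (j.+1%:R * (l [set e] : K)) != 0.
    by rewrite mulf_neq0 // (pcharf0P K).1.
  rewrite -[d ^+ j]scale1r -(mulVf c0) -scalerA -diffX.
  by rewrite memvZ // XP.
suff dX f : f \in agenv (delete W e) ->
    forall j, d ^+ j * f \in (linfun (@sqdiff K E e) @: agenv W)%VS.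
  by apply/subvP => f /dX/(_ 0%N); rewrite expr0 mul1r.
move: f; apply: agenv_ind => [j|a f g IHf IHg j|u f].
- by rewrite mulr1.
- by rewrite mulrDr -scalerAr memvD ?memvZ.
move=> /memv_imgP[w wW ->] IHf j; rewrite lfunE /=.
(* Splitting w along l leaves a form of the contraction, on which the
   substitution x_e = 0 acts trivially. *)
pose b := (w [set e] : K) / (l [set e] : K).
have mC : w - b *: l \in contract W e.
  rewrite mem_contract // memvB ?memvZ //=.
  by rewrite -scaleNr sqcoefD sqcoefZ mulNr mulfVK // subrr.
have -> : sqdrop e w = b *: d + (w - b *: l).
  by rewrite -(drop_contract mC) linearB linearZ addrC subrK.
rewrite mulrDl mulrDr memvD //.
  by rewrite -scalerAl -scalerAr mulrA -exprSr memvZ.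
rewrite mulrCA; have /memv_imgP[g gA ->] := IHf j.
have -> : (w - b *: l) * linfun (sqdiff e) g
    = linfun (@sqdiff K E e) ((w - b *: l) * g).
  by rewrite !lfunE /= sqdiffM (diff_contract mC) (drop_contract mC) mul0r add0r.
apply/memv_img/memA => //.
by move: mC; rewrite memv_cap => /andP[].
Qed.

Lemma dim_delete_contract W e l : (W <= sqhom K E 1)%VS -> l \in W ->
  (l [set e] : K) != 0 ->
  (\dim (agenv (delete W e)) + \dim (agenv (contract W e)) <= \dim (agenv W))%N.
Proof.
move=> W1 lW le; rewrite -(limg_ker_dim (linfun (@sqdiff K E e)) (agenv W)).
rewrite addnC leq_add //.
  exact/dimvS/agenv_contract_sub.
exact/dimvS/(agenv_delete_sub W1 lW le).
Qed.

(** The elements of E that are not loops of the matroid of W; they decrease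
    under deletion and contraction. *)
Definition active W : {set E} :=
  [set e | ~~ (W <= lker (linfun (@sqdiff K E e)))%VS].

Lemma activeP W e : (W <= sqhom K E 1)%VS ->
  reflect (exists2 l, l \in W & (l [set e] : K) != 0) (e \in active W).
Proof.
move=> W1; rewrite inE; apply: (iffP idP) => [/subvPn[l lW]|[l lW le]].
  rewrite memv_ker lfunE /= diff_lin ?(subvP W1) // => le; exists l => //.
  by apply: contra le => /eqP ->; rewrite scale0r.
apply/subvPn; exists l => //.
rewrite memv_ker lfunE /= diff_lin ?(subvP W1) //.
by rewrite scaler_eq0 negb_or le oner_eq0.
Qed.

Lemma delete_lin W e : (W <= sqhom K E 1)%VS -> (delete W e <= sqhom K E 1)%VS.
Proof.
move=> /subvP W1; apply/subvP => _ /memv_imgP[l /W1/sqhomP l1 ->].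
apply/sqhomP => S S1; rewrite lfunE sqcoef_drop; case: ifP => // _; exact: l1.
Qed.

Lemma contract_lin W e : (W <= sqhom K E 1)%VS -> (contract W e <= sqhom K E 1)%VS.
Proof. by apply: subv_trans; apply: capvSl. Qed.

Lemma active_delete W e : (W <= sqhom K E 1)%VS ->
  active (delete W e) \subset active W :\ e.
Proof.
move=> W1; apply/subsetP => x /(activeP _ (delete_lin e W1)).
case=> _ /memv_imgP[l lW ->]; rewrite lfunE sqcoef_drop in_setD1 inE [e == x]eq_sym.
have [_|_ lx] := eqVneq x e; first by rewrite eqxx.
by apply/activeP => //; exists l.
Qed.

Lemma active_contract W e : (W <= sqhom K E 1)%VS ->
  active (contract W e) \subset active W :\ e.
Proof.
move=> W1; apply/subsetP => x /(activeP _ (contract_lin e W1)).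
case=> l; rewrite mem_contract // => /andP[lW /eqP le] lx.
rewrite 2!inE; apply/andP; split; last by apply/activeP => //; exists l.
by apply: contraNneq lx => ->; rewrite le.
Qed.

(** Both sides are compared along the same recursion, the number of independent
    sets being subadditive and the dimension superadditive. *)
Theorem card_independent_le_dim W : (W <= sqhom K E 1)%VS ->
  (#|[set F | independent W F]| <= \dim (agenv W))%N.
Proof.
elim: {W}_.+1 {-2}W (ltnSn #|active W|) => // n IHn W; rewrite ltnS => actW W1.
have [act0|[e eW]] := set_0Vmem (active W).
  apply: (@leq_trans 1%N); last first.
    by have := dimvS (sub1_agenv W); rewrite dimv1.
  rewrite -(cards1 (set0 : {set E})); apply/subset_leq_card/subsetP => F.
  rewrite !inE => /independentP dualF; apply/eqP/setP => e; rewrite inE.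
  apply/negP => eF; have [l lW lE] := dualF e eF.
  have : e \in active W by apply/activeP => //; exists l; rewrite // lE // eqxx oner_neq0.
  by rewrite act0 inE.
have [l lW le] := activeP e W1 eW.
have small U : active U \subset active W :\ e -> (#|active U| < n)%N.
  by move=> /subset_leq_card /leq_ltn_trans; apply; rewrite (cardsD1 e) eW in actW.
apply: leq_trans (card_independent_le e W1) _.
apply: leq_trans (dim_delete_contract W1 lW le); apply: leq_add.
  by apply: IHn; rewrite ?delete_lin ?small ?active_delete.
by apply: IHn; rewrite ?contract_lin ?small ?active_contract.
Qed.
End Dimension.

(** * Upper bound: coordinates at complements of saturated sets *)

Section ExternalActivity.
Variable E : finType.
Implicit Types (T X : {set E}) (c e t : E) (ind : pred {set E}).

Definition before T c : {set E} := [set t in T | enum_rank t < enum_rank c]%N.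

(** For the independent sets of a matroid, this says that c is outside the
    closure of X, or is a member of X that lies in every basis of X. *)
Definition fresh ind X c :=
  [forall I : {set E}, (I \subset X) && ind I ==> ind (c |: I)].

Lemma freshP ind X c :
  reflect (forall I : {set E}, I \subset X -> ind I -> ind (c |: I))
          (fresh ind X c).
Proof.
apply: (iffP forallP) => [fr I IX indI|fr I].
  by have /implyP := fr I; rewrite IX indI; apply.
by apply/implyP => /andP[]; apply: fr.
Qed.

(** These sets are stated through ind alone, so that they can be compared
    between two matrices having the same independent sets of columns. They are
    the independent sets enlarged by their externally active elements. *)
Definition saturated ind T := [forall c, (c \in T) || fresh ind (before T c) c].

(** The basis of T produced by the greedy algorithm in increasing order. *)
Definition greedy ind T := [set t in T | fresh ind (before T t) t].

Lemma eq_saturated ind1 ind2 : ind1 =1 ind2 -> saturated ind1 =1 saturated ind2.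
Proof.
move=> eq_ind T; apply: eq_forallb => c; congr (_ || _).
by apply: eq_forallb => I; rewrite !eq_ind.
Qed.
End ExternalActivity.

Section UpperBound.
Variables (K : fieldType) (E : finType).
Local Notation B := (sqfree K E).
Variable W : {vspace B}.
Hypothesis W1 : (W <= sqhom K E 1)%VS.
Implicit Types (f g u l : B) (F I R S T X : {set E}) (e c t : E).
Local Notation ind := (independent W).

Lemma vanish_fresh X c l : l \in W -> (forall x, x \in X -> (l [set x] : K) = 0) ->
  (l [set c] : K) != 0 -> fresh ind X c.
Proof.
move=> lW lX lc; apply/freshP => I /subsetP sIX indI.
by apply: independentU1 lc => // x /sIX/lX.
Qed.

Lemma independent_greedy T : ind (greedy ind T).
Proof.
suff indn n : ind [set t in greedy ind T | enum_rank t < n]%N.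
  have := indn #|E|; congr ind; apply/setP => t.
  by rewrite inE ltn_ord andbT.
elim: n => [|n IHn].
  by apply/independentP => e; rewrite inE ltn0 andbF.
have [/existsP[t /andP[tG /eqP tn]]|] :=
  boolP [exists t in greedy ind T, enum_rank t == n :> nat].
  have -> : [set x in greedy ind T | enum_rank x < n.+1]%N
          = t |: [set x in greedy ind T | enum_rank x < n]%N.
    apply/setP => x; rewrite !(inE, ltnS) leq_eqVlt -tn (inj_eq val_inj).
    rewrite (inj_eq enum_rank_inj); case: eqP => //= ->.
    by rewrite inE in tG; rewrite tG.
  move: tG; rewrite inE => /andP[_ /freshP]; apply => //.
  by apply/subsetP => x; rewrite !inE -tn => /andP[/andP[-> _] ->].
rewrite negb_exists => /forallP noT.
have -> : [set x in greedy ind T | enum_rank x < n.+1]%N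
        = [set x in greedy ind T | enum_rank x < n]%N; last exact: IHn.
apply/setP => x; rewrite [LHS]inE [RHS]inE ltnS leq_eqVlt; have := noT x.
by case: (x \in greedy _ _) => //= /negPf ->.
Qed.

(** An element of T rejected by the greedy algorithm depends on smaller
    elements of T, hence on smaller elements of the greedy basis. *)
Lemma vanish_greedy T c l : l \in W ->
  (forall x, x \in before (greedy ind T) c -> (l [set x] : K) = 0) ->
  forall x, x \in before T c -> (l [set x] : K) = 0.
Proof.
move=> lW lG x; move: {2}(enum_rank x).+1 (ltnSn (enum_rank x)) => n.
elim: n x => // n IHn x; rewrite ltnS => xn; rewrite inE => /andP[xT xc].
have [xfr|] := boolP (fresh ind (before T x) x).
  by apply: lG; rewrite !inE xT xfr.
apply: contraNeq => lx; apply: vanish_fresh lx => // y.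
rewrite inE => /andP[yT yx]; apply: IHn; first exact: leq_trans xn.
by rewrite inE yT (ltn_trans yx).
Qed.

Lemma fresh_greedy T c :
  fresh ind (before T c) c = fresh ind (before (greedy ind T) c) c.
Proof.
apply/idP/idP => [/freshP fr|/freshP fr].
  apply/freshP => I sI; apply: fr; apply: subset_trans sI _.
  by apply/subsetP => x; rewrite !inE => /andP[/andP[-> _] ->].
have /independentP/(_ c (setU11 _ _))[l lW lE] : ind (c |: before (greedy ind T) c).
  apply: fr => //; apply: independentS (independent_greedy T).
  by apply/subsetP => x; rewrite inE => /andP[].
have nc X : c \notin before X c by rewrite inE ltnn andbF.
apply: (@vanish_fresh _ _ l) => //; last by rewrite lE ?setU11 // eqxx oner_neq0.
apply: vanish_greedy => // x xG; rewrite lE ?setU1r //.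
by case: eqP => // xc; rewrite xc (negPf (nc _)) in xG.
Qed.

(** A saturated set consists of its greedy basis F and of the elements that
    depend on the smaller elements of F; it is thus determined by F. *)
Lemma saturatedE T c : saturated ind T ->
  (c \in T) = (c \in greedy ind T) || ~~ fresh ind (before (greedy ind T) c) c.
Proof.
move=> /forallP/(_ c); rewrite -fresh_greedy inE.
by case: (c \in T) (fresh _ _ _) => [] [].
Qed.

Lemma card_saturated_le :
  (#|[set T | saturated ind T]| <= #|[set F | ind F]|)%N.
Proof.
rewrite -(card_in_imset (f := greedy ind)) => [|T1 T2]; last first.
  rewrite !inE => sat1 sat2 eqG; apply/setP => c.
  by rewrite (saturatedE c sat1) (saturatedE c sat2) eqG.
apply/subset_leq_card/subsetP => _ /imsetP[T _ ->].
by rewrite inE independent_greedy.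
Qed.

(** Subtracting from l its interpolation on I by a dual family leaves a form
    that vanishes on I, and then at c as well by independentU1: this is the
    expression of column c in terms of the columns in I. *)
Lemma dependent_relation I c : ind I -> c \notin I -> ~~ ind (c |: I) ->
  exists lam : E -> K, [/\ lam c = 1, forall e, lam e != 0 -> e \in c |: I &
    forall l, l \in W -> \sum_e lam e * (l [set e] : K) = 0].
Proof.
move=> indI cI dep; have [d dP] := dual_family indI.
exists (fun e => if e == c then 1 else if e \in I then - (d e [set c] : K) else 0).
split=> [|e|l lW]; first by rewrite eqxx.
  by rewrite !inE; case: (e == c); case: (e \in I); rewrite // eqxx.
have [l' l'W l'I] : exists2 l', l' \in W &
    l' = l - \sum_(e in I) (l [set e] : K) *: d e.
  exists (l - \sum_(e in I) (l [set e] : K) *: d e) => //.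
  by rewrite memvB // rpred_sum // => e /dP[dW _]; rewrite memvZ.
have coefl' x : (l' [set x] : K)
    = (l [set x] : K) - \sum_(e in I) (l [set e] : K) * (d e [set x] : K).
  rewrite l'I -scaleN1r sqcoefD sqcoefZ sqcoef_sum mulN1r.
  by congr (_ - _); apply: eq_bigr => e _; rewrite sqcoefZ.
have l'c : (l' [set c] : K) = 0.
  apply: contraNeq dep => l'c; apply: independentU1 l'c => // x xI.
  rewrite coefl' (bigD1 x) //= (dP x xI).2 // eqxx mulr1.
  rewrite big1 ?addr0 ?subrr // => e /andP[eI ex].
  by rewrite (dP e eI).2 // eq_sym (negPf ex) mulr0.
rewrite -[RHS]l'c coefl' (bigD1 c) //= eqxx mul1r; congr (_ + _).
rewrite -sumrN (bigID (fun e => e \in I)) /= [X in _ + X]big1 ?addr0; last first.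
  by move=> e /andP[/negPf -> /negPf ->]; rewrite mul0r.
apply: eq_big => [e|e /andP[/negPf -> ->]]; last by rewrite mulNr mulrC.
by rewrite andb_idl // => eI; apply: contraNneq cI => <-.
Qed.

Lemma sqcoefMU1 u f e R : u \in sqhom K E 1 -> e \notin R ->
  ((u * f) (e |: R) : K) = (u [set e] : K) * (f R : K)
    + \sum_(A : {set E} | A \subset R) (u A : K) * (f (e |: R :\: A) : K).
Proof.
move=> u1 eR.
have -> : ((u * f) (e |: R) : K) = sqdiff e (u * f) R by rewrite sqcoef_diff (negPf eR).
rewrite sqdiffM (diff_lin _ u1) -scalerAl mul1r sqcoefD sqcoefZ sqcoef_drop (negPf eR).
rewrite sqcoefM; congr (_ + _); apply: eq_bigr => A AR.
rewrite sqcoef_drop sqcoef_diff inE (negPf eR) andbF.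
by rewrite (contraNF ((subsetP AR) e) eR).
Qed.

(** The operator sum_e lam_e d/dx_e kills W. By the Leibniz rule, it behaves on
    a product like a derivation as far as the coordinates disjoint from the
    support of lam are concerned. *)
Lemma relation_agenv (lam : E -> K) :
  (forall l, l \in W -> \sum_e lam e * (l [set e] : K) = 0) ->
  forall f, f \in agenv W -> forall R, (forall e, lam e != 0 -> e \notin R) ->
  \sum_e lam e * (f (e |: R) : K) = 0.
Proof.
move=> relW; apply: agenv_ind => [R _|a f g IHf IHg R lamR|u f uW IHf R lamR].
- rewrite big1 // => e _; rewrite sqcoef1 -subset0 subUset sub1set inE.
  exact: mulr0.
- under eq_bigr => e _ do rewrite sqcoefD sqcoefZ mulrDr mulrCA.
  by rewrite big_split /= -mulr_sumr IHf // IHg // mulr0 addr0.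
transitivity (\sum_e (lam e * (u [set e] : K) * (f R : K)
    + \sum_(A : {set E} | A \subset R) (u A : K) * (lam e * (f (e |: R :\: A) : K)))).
  apply: eq_bigr => e _; have [le0|/lamR eR] := eqVneq (lam e) 0.
    by rewrite le0 !mul0r big1 ?addr0 // => A _; rewrite mul0r mulr0.
  rewrite sqcoefMU1 ?(subvP W1) // mulrDr mulrA; congr (_ + _).
  by rewrite mulr_sumr; apply: eq_bigr => A _; rewrite mulrCA.
rewrite big_split /= -mulr_suml relW // mul0r add0r exchange_big /= big1 // => A AR.
rewrite -mulr_sumr IHf ?mulr0 // => e /lamR eR.
by rewrite inE (negPf eR) andbF.
Qed.

(** If c makes the complement T of S unsaturated, the relation between c and
    smaller elements t of T expresses the coordinate of f at S through those at
    S - c + t, for which the sum of the ranks of the elements is smaller. *)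
Lemma saturated_separating f : f \in agenv W ->
  (forall T, saturated ind T -> (f (~: T) : K) = 0) -> f = 0.
Proof.
move=> fA satf; pose wt S := (\sum_(e in S) enum_rank e)%N.
suff f0 n S : (wt S < n)%N -> (f S : K) = 0.
  by apply/ffunP => S; rewrite sqcoef0 (f0 (wt S).+1).
elim: n S => // n IHn S; rewrite ltnS => wtS.
have [satS|] := boolP (saturated ind (~: S)); first by rewrite -[S]setCK satf.
rewrite negb_forall => /existsP[c]; rewrite negb_or inE negbK => /andP[cS].
rewrite negb_forall => /existsP[I]; rewrite negb_imply => /andP[/andP[sI indI] dep].
have IP x : x \in I -> x \notin S /\ (enum_rank x < enum_rank c)%N.
  by move=> /(subsetP sI); rewrite !inE => /andP[].
have cI : c \notin I by apply/negP => /IP[]; rewrite cS.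
have [lam [lamc lamI relW]] := dependent_relation indI cI dep.
have lamS e : lam e != 0 -> e \notin S :\ c.
  by move=> /lamI; rewrite !inE => /predU1P[->|/IP[/negPf -> _]]; rewrite ?eqxx ?andbF.
have := relation_agenv relW fA lamS.
rewrite (bigD1 c) //= lamc mul1r setD1K // big1 ?addr0 // => e ec.
have [->|/[dup] /lamI] := eqVneq (lam e) 0; first by rewrite mul0r.
rewrite !inE (negPf ec) /= => eI _; have [eS lt_ec] := IP e eI.
rewrite IHn ?mulr0 //; apply: leq_trans wtS.
rewrite /wt big_setU1 /=; last by rewrite !inE negb_and (negPf eS) orbT.
by rewrite [ltnRHS](big_setD1 c cS) /= ltn_add2r.
Qed.

(** The algebra is graded, being generated by forms of degree one. *)
Lemma proj_agenv f k : f \in agenv W ->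
  sqproj [set S : {set E} | #|S| == k] f \in agenv W.
Proof.
move=> fA; move: f fA k; apply: agenv_ind => [k|a f g IHf IHg k|u f uW IHf k].
- have -> : sqproj [set S : {set E} | #|S| == k] (1 : B) = (k == 0%N)%:R *: 1.
    apply/ffunP => S; rewrite sqcoefZ sqcoef_proj sqcoef1 inE.
    case: (eqVneq S set0) => [->|_]; rewrite ?cards0 ?mulr1 ?mulr0 ?if_same //.
    by rewrite eq_sym; case: ifP.
  by rewrite memvZ // memvE sub1_agenv.
- by rewrite linearP memvD ?memvZ ?IHf ?IHg /=.
have /sqhomP u1 := subvP W1 _ uW.
have -> : sqproj [set S : {set E} | #|S| == k] (u * f)
    = if k is k'.+1 then u * sqproj [set S : {set E} | #|S| == k'] f else 0.
  apply/ffunP => S; rewrite sqcoef_proj inE; case: eqP => [Sk|Sk].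
    case: k Sk => [/eqP|k] Sk.
      move: Sk; rewrite cards_eq0 => /eqP ->; rewrite sqcoef0 sqcoefM.
      rewrite big1 // => A; rewrite subset0 => /eqP ->.
      by rewrite u1 ?cards0 // mul0r.
    rewrite !sqcoefM; apply: eq_bigr => A AS; rewrite sqcoef_proj inE.
    have [A1|/u1 ->] := eqVneq #|A| 1%N; last by rewrite !mul0r.
    by rewrite cardsD (setIidPr AS) Sk A1 subSS subn0 eqxx.
  case: k Sk => [|k] Sk; first by rewrite sqcoef0.
  rewrite sqcoefM big1 // => A AS; rewrite sqcoef_proj inE.
  have [A1|/u1 ->] := eqVneq #|A| 1%N; last by rewrite mul0r.
  rewrite cardsD (setIidPr AS) A1 -eqSS -subSn ?subSS ?subn0; last first.
    by rewrite -A1 subset_leq_card.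
  by move/eqP/negPf: Sk => ->; rewrite mulr0.
case: k => [|k]; first exact: mem0v.
rewrite -(agenvM W) memv_mul //.
exact: subvP (sub_agenv W) _ uW.
Qed.

Hypothesis K0 : [pchar K] =i pred0.

Let X : {set {set E}} := [set S | saturated ind (~: S)].

Let card_X : #|X| = #|[set T | saturated ind T]|.
Proof.
rewrite -[LHS](card_imset _ (@setC_inj E)); apply: eq_card => T.
rewrite [RHS]inE; apply/imsetP/idP => [[S]|satT]; first by rewrite inE => + ->.
by exists (~: T); rewrite ?inE ?setCK.
Qed.

Let sepX f : f \in agenv W -> (forall S, S \in X -> (f S : K) = 0) -> f = 0.
Proof.
move=> fA fX; apply: saturated_separating => // T satT.
by rewrite fX // inE setCK.
Qed.

Let dim_agenv_le : (\dim (agenv W) <= #|X|)%N.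
Proof. by rewrite -(dim_le_separating sepX) -(dim_sqspan K X) dimvS ?limg_proj_sub. Qed.

(** The chain dim <= #saturated <= #independent <= dim closes up. *)
Theorem dim_agenv : \dim (agenv W) = #|[set F | ind F]|.
Proof.
apply/eqP; rewrite eqn_leq card_independent_le_dim // andbT.
by apply: leq_trans dim_agenv_le _; rewrite card_X card_saturated_le.
Qed.

(** Since all the bounds are equalities, the algebra contains a family dual to
    the coordinates at complements of saturated sets, and the degree k parts of
    its members are dual to those of these coordinates that have degree k. *)
Theorem dim_agenv_hom k :
  \dim (agenv W :&: sqhom K E k) =
    #|[set S : {set E} | saturated ind (~: S) & #|S| == k]|.
Proof.
have /interpolationP interp : \dim (linfun (sqproj X) @: agenv W) == #|X|.
  rewrite (dim_le_separating sepX) eqn_leq dim_agenv_le card_X.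
  by rewrite (leq_trans card_saturated_le) // dim_agenv.
set Xk := [set S : {set E} | _ & _].
have XkE S : (S \in Xk) = (S \in X) && (#|S| == k) by rewrite !inE.
rewrite -(@dim_le_separating _ _ Xk); last first.
  move=> f; rewrite memv_cap => /andP[fA /sqhomP fk] f0; apply: sepX => // S SX.
  by have [Sk|/fk //] := eqVneq #|S| k; apply: f0; rewrite XkE SX Sk eqxx.
apply/eqP/interpolationP => S; rewrite XkE => /andP[SX Sk].
have [f fA fS] := interp S SX.
exists (sqproj [set T : {set E} | #|T| == k] f).
  rewrite memv_cap proj_agenv //; apply/sqhomP => T Tk.
  by rewrite sqcoef_proj inE (negPf Tk).
by move=> T; rewrite XkE => /andP[TX Tk]; rewrite sqcoef_proj inE Tk fS.
Qed.
End UpperBound.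

(** * Cycles in multigraphs *)

Lemma set2_eqP (T : finType) (a b c d : T) :
  [set a; b] = [set c; d] -> (a = c /\ b = d) \/ (a = d /\ b = c).
Proof.
move=> eq_ab; have := set21 c d; have := set22 c d; rewrite -eq_ab.
move=> /set2P d_ab /set2P c_ab.
have := set21 a b; have := set22 a b; rewrite eq_ab.
move=> /set2P b_cd /set2P a_cd.
by case: d_ab c_ab b_cd a_cd => [] ? [] ? [] ? [] ?; subst; auto.
Qed.

Section Graph.
Variable G : mgraph.
Local Notation V := (vertex G).
Local Notation E := (edge G).
Implicit Types (F S D : {set E}) (u v w x y : V) (e f : E).

Lemma card_ends e : (0 < #|ends e| <= 2)%N.
Proof. by case: G e. Qed.

Lemma adjacent_sym F : symmetric (adjacent F).
Proof. by move=> u v; apply: eq_existsb => e; rewrite setUC. Qed.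

Lemma connect_edge F e x y :
  e \in F -> x \in ends e -> y \in ends e -> connect (adjacent F) x y.
Proof.
move=> eF xe ye; have [->|xy] := eqVneq x y; first exact: connect0.
apply/connect1/existsP; exists e.
rewrite eF eq_sym eqEcard cards2 xy subUset !sub1set xe ye.
by case/andP: (card_ends e).
Qed.

Lemma connectS F1 F2 x y : F1 \subset F2 ->
  connect (adjacent F1) x y -> connect (adjacent F2) x y.
Proof.
move=> /subsetP sF; apply: connect_sub => u v /existsP[e /andP[eF ends_e]].
by apply/connect1/existsP; exists e; rewrite sF.
Qed.

(** The cycle length is a parameter, whereas is_cycle indexes the walk by the
    cardinal of the edge set. *)
Lemma is_cycle_intro n (v : 'I_n -> V) (e : 'I_n -> E) :
  (0 < n)%N -> injective v -> injective e ->
  (forall i, ends (e i) = [set v i; v (ordS i)]) ->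
  is_cycle [set e i | i : 'I_n].
Proof.
move=> n0 v_inj e_inj ends_e; rewrite /is_cycle.
have cardS : #|[set e i | i : 'I_n]| = n by rewrite card_imset // card_ord.
rewrite cardS n0 /=.
apply/existsP; exists (finfun v); apply/existsP; exists (finfun e).
apply/and4P; split.
- by apply/injectiveP => i j; rewrite !ffunE; apply: v_inj.
- by apply/injectiveP => i j; rewrite !ffunE; apply: e_inj.
- by apply/eqP/eq_imset => i; rewrite ffunE.
- by apply/forallP => i; rewrite !ffunE ends_e.
Qed.

Lemma is_cycleP S : is_cycle S ->
  exists n (v : 'I_n -> V) (e : 'I_n -> E),
    [/\ (0 < n)%N, injective e, S = [set e i | i : 'I_n] &
        forall i, ends (e i) = [set v i; v (ordS i)]].
Proof.
case/andP=> S0 /existsP[v /existsP[e]].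
case/and4P=> _ /injectiveP e_inj /eqP eS /forallP ends_e.
by exists #|S|, v, e; split=> // i; apply/eqP.
Qed.

(** A path without repeated vertices from u to w is closed by e. *)
Lemma cycle_through F e u w :
  ends e = [set u; w] -> e \notin F -> connect (adjacent F) u w ->
  exists S, [/\ is_cycle S, e \in S, S \subset e |: F &
    forall f x, f \in S -> x \in ends f -> connect (adjacent F) u x].
Proof.
move=> ends_e eF /connectP[p0 path_p0 w_last].
move: ends_e; rewrite w_last; case/shortenP: path_p0 => p path_p uniq_p _ ends_e.
set n := size p; pose v (i : 'I_n.+1) := nth u (u :: p) i.
have v_inj : injective v.
  by move=> i j /eqP; rewrite nth_uniq //= ?ltnS ?leq_ord // => /eqP/val_inj.
have [ed edP] : exists ed : 'I_n.+1 -> E, forall i,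
    ends (ed i) = [set v i; v (ordS i)] /\
    (if (i < n)%N then ed i \in F else ed i == e).
  apply: (fin_all_exists (P := fun i f => ends f = [set v i; v (ordS i)] /\
    (if (i < n)%N then f \in F else f == e))) => i.
  rewrite /v /=; case: ltnP => [lt_in|le_ni].
    have /existsP[f /andP[fF /eqP ends_f]] := pathP u path_p i lt_in.
    by exists f; split=> //; rewrite modn_small.
  have -> : i = n :> nat by apply/eqP; rewrite eqn_leq -ltnS ltn_ord.
  by exists e; split; rewrite ?eqxx // ends_e modnn /= setUC (last_nth u).
have ed_inj : injective ed.
  move=> i j eq_ij; have [ends_i Fi] := edP i; have [ends_j Fj] := edP j.
  case: (ltnP i n) Fi => [lt_in|le_ni] Fi; case: (ltnP j n) Fj => [lt_jn|le_nj] Fj.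
  - move: ends_i; rewrite eq_ij ends_j => /set2_eqP[[/v_inj -> //]|].
    case=> /v_inj j_i /v_inj/(congr1 val).
    move: lt_jn; rewrite j_i /= [(i.+1 %% _)%N]modn_small // => lt_in1.
    by rewrite modn_small // => /eqP; rewrite -addn2 -{2}[val i]addn0 eqn_add2l.
  - by rewrite -(eqP Fj) -eq_ij Fi in eF.
  - by rewrite -(eqP Fi) eq_ij Fj in eF.
  - have last_ord (k : 'I_n.+1) : (n <= k)%N -> k = n :> nat.
      by move=> le_nk; apply/eqP; rewrite eqn_leq leq_ord.
    by apply/val_inj; rewrite /= (last_ord i le_ni) (last_ord j le_nj).
exists [set ed i | i : 'I_n.+1]; split.
- by apply: is_cycle_intro v_inj ed_inj _ => // i; case: (edP i).
- apply/imsetP; exists ord_max => //; have [_] := edP ord_max.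
  by rewrite ltnn => /eqP ->.
- apply/subsetP => _ /imsetP[i _ ->]; have [_] := edP i; rewrite !inE.
  by case: ifP => [_ ->|_ ->]; rewrite ?orbT.
move=> _ x /imsetP[i _ ->]; have [-> _] := edP i.
by rewrite !inE => /orP[]/eqP ->; apply: (path_connect path_p);
  apply: mem_nth; apply: ltn_ord.
Qed.
End Graph.

(** * Potentials and pseudoforests *)

Section Cycles.
Variable G : mgraph.
Local Notation V := (vertex G).
Local Notation E := (edge G).
Implicit Types (F S D : {set E}) (u v w x y r : V) (e f : E).
Variable sigma : orientation G.
Local Notation s := (src sigma).
Local Notation t := (tgt sigma).

Lemma ends_orient e : ends e = [set s e; t e].
Proof. by case: sigma. Qed.

Lemma src_end e : s e \in ends e. Proof. by rewrite ends_orient set21. Qed.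
Lemma tgt_end e : t e \in ends e. Proof. by rewrite ends_orient set22. Qed.

Lemma connect_invariant F (Z : pred V) x y :
  (forall f, f \in F -> Z (s f) = Z (t f)) -> connect (adjacent F) x y -> Z x = Z y.
Proof.
move=> ZF; apply: closed_connect => u v /existsP[f /andP[fF /eqP]].
rewrite ends_orient => /set2_eqP[[<- <-]|[<- <-]]; first exact: ZF.
by symmetry; apply: ZF.
Qed.

(** Around a closed walk the changes of Z cancel out, so exactly one edge cannot
    carry a change: removing e does not separate its ends. *)
Lemma cycle_invariant S e (Z : pred V) : is_cycle S -> e \in S ->
  (forall f, f \in S -> f != e -> Z (s f) = Z (t f)) -> Z (s e) = Z (t e).
Proof.
move=> /is_cycleP[n [v [ed [_ ed_inj -> ends_ed]]]] /imsetP[i _ ->] Zf.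
have Z_iff j : Z (s (ed j)) = Z (t (ed j)) <-> Z (v j) = Z (v (ordS j)).
  have := ends_ed j; rewrite ends_orient => /set2_eqP[[-> ->]|[-> ->]] //.
  by split=> ->.
apply/Z_iff; have : (\sum_j Z (v (ordS j)) = \sum_j Z (v j))%N.
  by rewrite [RHS](reindex_inj (@ordS_inj n)).
rewrite (bigD1 i) //= [RHS](bigD1 i) //=.
rewrite (eq_bigr (fun j => Z (v j) : nat)) => [/addIn|j ji].
  by case: (Z (v i)) (Z _) => [] [].
congr nat_of_bool; symmetry; apply/Z_iff/Zf; first exact: imset_f.
by rewrite (inj_eq ed_inj).
Qed.

Section Gain.
Variables (K : fieldType) (gamma : E -> K).
Hypothesis gamma_neq0 : forall e, gamma e != 0.

Definition balanced (psi : V -> K) e := gamma e * psi (t e) == psi (s e).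

Lemma balanced_neq0 psi e : balanced psi e -> (psi (t e) != 0) = (psi (s e) != 0).
Proof. by move=> /eqP <-; rewrite mulf_eq0 negb_or gamma_neq0. Qed.

Hypothesis unbalanced : forall S, is_cycle S -> forall P : {set E}, P \subset S ->
  \prod_(e in P) gamma e != \prod_(e in S :\: P) gamma e.

(** Let P be the set of the edges traversed from source to target. If psi had no
    zero on the cycle, multiplying the balance equations of its edges and
    cancelling the product of the values of psi would equate the products of
    the gains over P and over its complement in S. *)
Lemma cycle_potential_eq0 S psi : is_cycle S -> (forall e, e \in S -> balanced psi e) ->
  exists2 e, e \in S & psi (s e) = 0.
Proof.
move=> cycS balS; have [/existsP[e /andP[eS /eqP]]|] :=
  boolP [exists e in S, psi (s e) == 0].
  by exists e.
rewrite negb_exists => /forallP nz; exfalso.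
have [n [v [ed [_ ed_inj defS ends_ed]]]] := is_cycleP cycS.
have edS i : ed i \in S by rewrite defS imset_f.
have nzs i : psi (s (ed i)) != 0 by have := nz (ed i); rewrite edS.
have nzt i : psi (t (ed i)) != 0 by rewrite balanced_neq0 ?balS.
have nzv i : psi (v i) != 0.
  by have := set21 (v i) (v (ordS i)); rewrite -ends_ed ends_orient => /set2P[] ->.
pose fwd i := s (ed i) == v i.
pose P := [set ed i | i in fwd].
have PS : P \subset S by apply/subsetP => _ /imsetP[i _ ->].
have SP : S :\: P = [set ed i | i in predC fwd].
  apply/setP => x; rewrite inE defS; apply/andP/imsetP.
    case=> xP /imsetP[i _ xi]; exists i => //.
    by apply: contraNN xP => fi; rewrite xi imset_f.
  case=> i nfi ->; split; last exact: imset_f.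
  by apply/imsetP => -[j fj /ed_inj ij]; rewrite ij in nfi; case/negP: nfi.
case/negP: (unbalanced cycS PS); apply/eqP.
rewrite SP !big_imset; try by move=> i j _ _ /ed_inj.
have prod_neq0 : \prod_i psi (v i) != 0 by apply/prodf_neq0 => i _.
apply: (mulIf prod_neq0).
(* After a cyclic shift on one side, the factors at i on both sides are the
   two sides of the balance equation of the i-th edge. *)
rewrite [X in _ * X = _](reindex_inj (@ordS_inj n)) /= big_mkcond.
rewrite [X in _ = X * _]big_mkcond -!big_split /=.
apply: eq_bigr => i _; rewrite -!topredE /=.
have /eqP bal_i := balS _ (edS i).
have := ends_ed i; rewrite ends_orient => /set2_eqP[[si ti]|[si ti]].
  by rewrite /fwd si eqxx /= mul1r -ti bal_i si.
have [/eqP fi|_] := boolP (fwd i); last by rewrite mul1r -ti bal_i si.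
by rewrite ti -fi in bal_i; rewrite mul1r -si -fi.
Qed.

(** An edge e of an acyclic set F joins two components of F - e. Rescaling the
    potential of F - e on one of them balances e. *)
Lemma acyclic_potential F : (forall S, is_cycle S -> ~~ (S \subset F)) ->
  exists psi : V -> K, (forall x, psi x != 0) /\ forall f, f \in F -> balanced psi f.
Proof.
elim: {F}_.+1 {-2}F (ltnSn #|F|) => // n IHn F; rewrite ltnS => cardF acyc.
have [->|[e eF]] := set_0Vmem F.
  by exists (fun=> 1); split=> [x|f]; rewrite ?oner_neq0 ?inE.
have [||psi [psi_neq0 balpsi]] := IHn (F :\ e).
- by rewrite (cardsD1 e F) eF in cardF.
- by move=> S /acyc; apply: contra => /subset_trans; apply; apply: subD1set.
pose conn := connect (adjacent (F :\ e)).
have not_conn : ~~ conn (t e) (s e).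
  apply/negP; rewrite /conn (sym_connect_sym (@adjacent_sym _ _)) => conn_e.
  have [|S [cycS _ SF _]] := cycle_through (ends_orient e) _ conn_e.
    by rewrite !inE eqxx.
  by case/negP: (acyc S cycS); rewrite setD1K in SF.
pose c := psi (s e) / (gamma e * psi (t e)).
have ge : gamma e * psi (t e) != 0 by rewrite mulf_neq0.
exists (fun x => if conn (t e) x then c * psi x else psi x); split=> [x|f fF].
  by case: ifP => // _; rewrite !mulf_neq0 ?invr_neq0.
rewrite /balanced; have [->|fe] := eqVneq f e.
  by rewrite (negPf not_conn) /conn connect0 mulrCA divfK.
have fF1 : f \in F :\ e by rewrite !inE fe.
have -> : conn (t e) (t f) = conn (t e) (s f).
  apply/esym/same_connect_r; first exact/sym_connect_sym/adjacent_sym.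
  exact: connect_edge fF1 (src_end f) (tgt_end f).
have /eqP bal_f := balpsi f fF1.
by case: ifP => _; [rewrite mulrCA bal_f | rewrite bal_f].
Qed.

(** Extending by zero is harmless as no edge of F leaves the component of r. *)
Lemma component_potential F r :
  (forall S, is_cycle S -> ~~ (S \subset component_edges F r)) ->
  exists psi : V -> K, (forall f, f \in F -> balanced psi f) /\
    forall x, (psi x != 0) = connect (adjacent F) r x.
Proof.
move=> /acyclic_potential[psi [psi_neq0 balpsi]].
exists (fun x => if connect (adjacent F) r x then psi x else 0).
split=> [f fF|x]; last by case: ifP; rewrite ?psi_neq0 ?eqxx.
rewrite /balanced.
have -> : connect (adjacent F) r (t f) = connect (adjacent F) r (s f).
  apply/esym/same_connect_r; first exact/sym_connect_sym/adjacent_sym.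
  exact: connect_edge fF (src_end f) (tgt_end f).
case: ifP => [rs|_]; last by rewrite mulr0.
apply: balpsi; rewrite inE fF; apply/existsP; exists (s f).
by rewrite src_end.
Qed.

Definition form (psi : V -> K) := \sum_v psi v *: circ_gen sigma gamma v.

Definition circ_space : {vspace sqfree K E} :=
  <<[seq circ_gen sigma gamma v | v : V]>>%VS.

Lemma circ_gen_lin v : circ_gen sigma gamma v \in sqhom K E 1.
Proof.
apply: rpred_sum => e _; apply: memvZ; apply/sqhomP => S S1.
by rewrite sqcoef_delta; case: eqP => // Se; rewrite Se cards1 in S1.
Qed.

Lemma circ_space_lin : (circ_space <= sqhom K E 1)%VS.
Proof. by apply/span_subvP => _ /imageP[v _ ->]; apply: circ_gen_lin. Qed.

(** A single formula covers loops, where both terms contribute to the same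
    vertex. *)
Lemma incidenceE v e :
  incidence sigma gamma v e = gamma e * (v == t e)%:R - (v == s e)%:R.
Proof.
rewrite /incidence /is_loop ends_orient cards2 !inE negb_or.
have [->|vs] := eqVneq v (s e); have [|] := eqVneq (s e) (t e) => st //=.
- by rewrite mulr1.
- by rewrite mulr0 sub0r.
- by rewrite -st (negPf vs) mulr0 subrr.
by case: eqP; rewrite ?mulr0 ?mulr1 subr0.
Qed.

Lemma coef_circ_gen v e : (circ_gen sigma gamma v [set e] : K) = incidence sigma gamma v e.
Proof.
rewrite sqcoef_sum (bigD1 e) //= big1 => [|f fe].
  by rewrite sqcoefZ sqcoef_delta eqxx mulr1 addr0.
by rewrite sqcoefZ sqcoef_delta (inj_eq set1_inj) eq_sym (negPf fe) mulr0.
Qed.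

Lemma coef_form psi e : (form psi [set e] : K) = gamma e * psi (t e) - psi (s e).
Proof.
rewrite sqcoef_sum.
under eq_bigr => v _ do rewrite sqcoefZ coef_circ_gen incidenceE mulrBr mulrCA.
rewrite sumrB -mulr_sumr; congr (_ * _ - _).
  rewrite (bigD1 (t e)) //= eqxx mulr1 big1 ?addr0 // => v /negPf ->.
  by rewrite mulr0.
rewrite (bigD1 (s e)) //= eqxx mulr1 big1 ?addr0 // => v /negPf ->.
by rewrite mulr0.
Qed.

Lemma form_mem psi : form psi \in circ_space.
Proof. by apply: rpred_sum => v _; apply/memvZ/memv_span/image_f. Qed.

Lemma circ_spaceP l : l \in circ_space -> exists psi, l = form psi.
Proof.
rewrite /circ_space span_def big_image => /memv_sumP[g gE ->].
have [psi psiE] : exists psi : V -> K, forall v, g v = psi v *: circ_gen sigma gamma v.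
  by apply: (fin_all_exists (P := fun v a => g v = a *: _)) => v; apply/vlineP/gE.
by exists psi; apply: eq_bigr => v _.
Qed.

Lemma circulationE : (circulation sigma gamma : {vspace _}) = agenv circ_space.
Proof.
apply: subv_anti; apply/andP; split; last exact/agenvS/addvSr.
apply: agenv_sub_modl; first exact: sub1_agenv.
rewrite -[X in (_ <= X)%VS]agenvM; apply: prodvSl.
by rewrite subv_add sub1_agenv sub_agenv.
Qed.

Lemma component_edges_sub F r : component_edges F r \subset F.
Proof. by apply/subsetP => e; rewrite inE => /andP[]. Qed.

Lemma mem_component F r e x : x \in ends e ->
  (e \in component_edges F r) = (e \in F) && connect (adjacent F) r x.
Proof.
move=> xe; rewrite inE; case: (boolP (e \in F)) => //= eF.
apply/existsP/idP => [[y /andP[ye ry]]|rx]; last by exists x; rewrite xe.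
exact: connect_trans ry (connect_edge eF ye xe).
Qed.

Lemma pseudoforestS F1 F2 : F1 \subset F2 -> is_pseudoforest F2 -> is_pseudoforest F1.
Proof.
move=> sF /forallP pf2; apply/forallP => v; apply: leq_trans (pf2 v).
apply/subset_leq_card/subsetP => S; rewrite !inE => /andP[-> /subsetP SF] /=.
apply/subsetP => e /SF; rewrite !(mem_component _ _ (src_end e)) => /andP[eF ve].
by rewrite (subsetP sF) // (connectS sF).
Qed.

Lemma pseudoforest_cycle_uniq F v S1 S2 : is_pseudoforest F ->
  is_cycle S1 -> S1 \subset component_edges F v ->
  is_cycle S2 -> S2 \subset component_edges F v -> S1 = S2.
Proof.
move=> /forallP/(_ v)/card_le1_eqP eqS cyc1 sub1 cyc2 sub2.
by apply: eqS; rewrite inE ?cyc1 ?cyc2.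
Qed.

(** Adding edges one at a time, it suffices to find a potential for the previous
    edges F0 that does not balance the new edge e. If F0 connects the ends of e,
    then e closes the only cycle of the component obtained, and the nowhere zero
    potential of the acyclic component of F0 cannot balance all the edges of
    this cycle. Otherwise e joins two components of F0, one of which has no
    cycle; the potential of that one is nonzero at exactly one end of e. *)
Lemma pseudoforest_independent F : is_pseudoforest F -> independent circ_space F.
Proof.
elim: {F}_.+1 {-2}F (ltnSn #|F|) => // n IHn F; rewrite ltnS => cardF pfF.
have [->|[e eF]] := set_0Vmem F; first by apply/independentP => e; rewrite inE.
pose F0 := F :\ e; have sF0 : F0 \subset F by apply: subD1set.
have eF0 : e \notin F0 by rewrite !inE eqxx.
have indF0 : independent circ_space F0.
  by apply: IHn (pseudoforestS sF0 pfF); rewrite (cardsD1 e F) eF in cardF.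
suff [psi [balpsi psi_e]] : exists psi : V -> K,
    (forall f, f \in F0 -> balanced psi f) /\ ~~ balanced psi e.
  rewrite -(setD1K eF); apply: (independentU1 (l := form psi)) => //.
  - exact: form_mem.
  - by move=> f /balpsi/eqP balf; rewrite coef_form balf subrr.
  - by rewrite coef_form subr_eq0.
have sub_comp r : connect (adjacent F) (s e) r ->
    component_edges F0 r \subset component_edges F (s e).
  move=> sr; apply/subsetP => f; rewrite !(mem_component _ _ (src_end f)) => /andP[fF rf].
  by rewrite (subsetP sF0) // (connect_trans sr) // (connectS sF0).
have [conn|not_conn] := boolP (connect (adjacent F0) (s e) (t e)).
  have [S [cycS eS SF S_conn]] := cycle_through (ends_orient e) eF0 conn.
  rewrite setD1K // in SF.
  have S_comp : S \subset component_edges F (s e).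
    apply/subsetP => f fS; rewrite (mem_component _ _ (src_end f)) (subsetP SF) //=.
    exact: connectS sF0 (S_conn f _ fS (src_end f)).
  have [S' cycS'|psi [balpsi psi_neq0]] := component_potential (F := F0) (r := s e).
    apply/negP => S'F; have S'S : S' = S.
      apply: pseudoforest_cycle_uniq pfF cycS' _ cycS S_comp.
      exact: subset_trans S'F (sub_comp _ (connect0 _ _)).
    have := subsetP S'F e; rewrite S'S eS => /(_ isT).
    by rewrite (mem_component _ _ (src_end e)) (negPf eF0).
  exists psi; split=> //; apply/negP => bale.
  have [f fS|f fS psif] := cycle_potential_eq0 (psi := psi) cycS.
    have [->//|fe] := eqVneq f e; apply: balpsi; rewrite !inE fe.
    exact: (subsetP SF).
  by have := psi_neq0 (s f); rewrite psif eqxx (S_conn f _ fS (src_end f)).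
have csym := sym_connect_sym (@adjacent_sym _ F0).
suff [r [re rE acyc]] : exists r, [/\ connect (adjacent F) (s e) r,
    connect (adjacent F0) r (s e) (+) connect (adjacent F0) r (t e) &
    forall S, is_cycle S -> ~~ (S \subset component_edges F0 r)].
  have [psi [balpsi psi_neq0]] := component_potential acyc.
  exists psi; split=> //; apply/negP => /balanced_neq0; rewrite !psi_neq0 => eqc.
  by rewrite eqc addbb in rE.
pose cyclic r := [exists S, is_cycle S && (S \subset component_edges F0 r)].
have acyclicP r : ~~ cyclic r -> forall S, is_cycle S -> ~~ (S \subset component_edges F0 r).
  by rewrite negb_exists => /forallP nc S cycS; have := nc S; rewrite cycS.
have [/existsP[S1 /andP[cyc1 sub1]]|/acyclicP] := boolP (cyclic (s e)); last first.
  by exists (s e); split=> //; rewrite connect0 (negPf not_conn).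
have et : connect (adjacent F) (s e) (t e) by apply: connect_edge eF (src_end e) (tgt_end e).
exists (t e); split=> //; first by rewrite connect0 csym (negPf not_conn).
apply: acyclicP; apply/negP => /existsP[S2 /andP[cyc2 sub2]].
have S12 : S1 = S2.
  apply: pseudoforest_cycle_uniq pfF cyc1 _ cyc2 _.
    exact: subset_trans sub1 (sub_comp _ (connect0 _ _)).
  exact: subset_trans sub2 (sub_comp _ et).
have /card_gt0P[f fS] : (0 < #|S1|)%N by case/andP: cyc1.
have := subsetP sub1 f fS; rewrite S12 in fS; have := subsetP sub2 f fS.
rewrite !(mem_component _ _ (src_end f)) => /andP[_ tf] /andP[_ sf].
by case/negP: not_conn; apply: connect_trans sf _; rewrite csym.
Qed.

(** Let S1 and S2 be cycles in one component and e an edge of S2 outside S1. A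
    potential balancing all edges but e has a zero on S1; by
    cycle_invariant for S2 its zeros spread to the whole component, hence to
    both ends of e. So no form of W is zero on F - e and nonzero at e. *)
Lemma independent_pseudoforest F : independent circ_space F -> is_pseudoforest F.
Proof.
move=> /independentP dualF; apply/forallP => v; rewrite leqNgt.
apply/negP => /card_gt1P[S1 [S2 []]]; rewrite !inE.
wlog [e eS2 eS1] : S1 S2 / exists2 e, e \in S2 & e \notin S1.
  move=> wl S1F S2F S12; have [S21|/subsetPn[e eS2 eS1]] := boolP (S2 \subset S1); last first.
    by apply: (wl S1 S2) => //; exists e.
  apply: (wl S2 S1) => //; last by rewrite eq_sym.
  by apply/subsetPn; apply: contra S12 => S1S2; rewrite eqEsubset S1S2.
move=> /andP[cyc1 /subsetP sub1] /andP[cyc2 /subsetP sub2] _.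
have compF := subsetP (component_edges_sub F v).
have eF : e \in F by apply/compF/sub2.
have [_ /circ_spaceP[psi ->] psiE] := dualF e eF.
have bal f : f \in F -> f != e -> balanced psi f.
  by move=> fF /negPf fe; rewrite /balanced -subr_eq0 -coef_form psiE // fe.
have [f fS1|f fS1 psif] := cycle_potential_eq0 (psi := psi) cyc1.
  by apply: bal; [apply/compF/sub1 | apply: contraNneq eS1 => <-].
pose Z x := psi x == 0.
have ZF g : g \in F -> Z (s g) = Z (t g).
  have Zbal h : h \in F -> h != e -> Z (s h) = Z (t h).
    by move=> hF /(bal h hF)/balanced_neq0/negb_inj zE; rewrite /Z zE.
  have [-> _|ge gF] := eqVneq g e; last exact: Zbal.
  apply: (cycle_invariant cyc2 eS2) => h hS2; apply: Zbal.
  exact/compF/sub2.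
have /andP[_ vf] : (f \in F) && connect (adjacent F) v (s f).
  by rewrite -(mem_component _ _ (src_end f)) sub1.
have /andP[_ ve] : (e \in F) && connect (adjacent F) v (s e).
  by rewrite -(mem_component _ _ (src_end e)) sub2.
have Zse : Z (s e) by rewrite -(connect_invariant ZF ve) (connect_invariant ZF vf) /Z psif.
have := psiE e eF; rewrite eqxx coef_form (eqP Zse).
by move: Zse; rewrite ZF // => /eqP ->; rewrite mulr0 subrr => /eqP; rewrite eq_sym oner_eq0.
Qed.

Lemma independentE : independent circ_space =1 @is_pseudoforest G.
Proof.
move=> F; apply/idP/idP; first exact: independent_pseudoforest.
exact: pseudoforest_independent.
Qed.
End Gain.
End Cycles.

Theorem theorem2p12 (K : fieldType) (K0 : [pchar K] =i pred0)
    (G : mgraph) (gamma : edge G -> K) (gamma_neq0 : forall e, gamma e != 0)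
    (unbalanced : forall S : {set edge G}, is_cycle S ->
       forall P : {set edge G}, P \subset S ->
         \prod_(e in P) gamma e != \prod_(e in S :\: P) gamma e) :
  (forall (sigma tau : orientation G) (k : nat),
     circ_hilbert sigma gamma k = circ_hilbert tau gamma k) /\
  (forall sigma : orientation G,
     \dim (circulation sigma gamma) =
       #|[set F : {set edge G} | is_pseudoforest F]|).
Proof.
have hilbertE sigma k : circ_hilbert sigma gamma k =
    #|[set S : {set edge G} | saturated (@is_pseudoforest G) (~: S) & #|S| == k]|.
  rewrite /circ_hilbert circulationE dim_agenv_hom ?circ_space_lin //.
  apply: eq_card => S; rewrite !inE; congr (_ && _).
  exact/eq_saturated/independentE.
split=> [sigma tau k|sigma]; first by rewrite !hilbertE.
rewrite circulationE dim_agenv ?circ_space_lin //.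
by apply: eq_card => F; rewrite !inE independentE.
Qed.
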